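(* Let $X$ be a uniformly perfect metric space with more than one point and let $F\subseteq X$ be non-empty and totally bounded. If $\dim_{\mathrm L}F<\dim_{\mathrm A}F<\infty$ then for all $\theta\in(0,1]$, $$\overline{\dim}_\theta F\ge\frac{\theta\dim_{\mathrm A}F\,(\overline{\dim}_{\mathrm B}F-\dim_{\mathrm L}F)+\dim_{\mathrm L}F\,(\dim_{\mathrm A}F-\overline{\dim}_{\mathrm B}F)}{\theta(\overline{\dim}_{\mathrm B}F-\dim_{\mathrm L}F)+(\dim_{\mathrm A}F-\overline{\dim}_{\mathrm B}F)}.$$ The same holds replacing $\overline{\dim}$ with $\underline{\dim}$ throughout.
   Context: For a subset $U$ of a metric space, $|U|$ denotes its diameter, and $B(x,r)$ is the open ball. Convention: $\inf\varnothing=\infty$. A metric space $X$ is uniformly perfect if there is $c\in(0,1)$ such that $B(x,R)\setminus B(x,cR)\neq\varnothing$ for all $x\in X$ and $0<R<|X|$. $N_\delta(F)$ is the smallest number of open balls of radius $\delta/2$ with centres in $F$ needed to cover $F$; $F$ is totally bounded if $N_\delta(F)<\infty$ for all $\delta>0$. Box dimensions: $\overline{\dim}_{\mathrm B}F$ and $\underline{\dim}_{\mathrm B}F$ are the $\limsup$ and $\liminf$ as $\delta\to0^+$ of $\log N_\delta(F)/(-\log\delta)$. Intermediate dimensions: for $\theta\in(0,1)$, the upper $\theta$-intermediate dimension $\overline{\dim}_\theta F$ is the infimum of all $s\ge0$ such that for all $\epsilon>0$ there exists $\delta_0\in(0,1]$ such that for all $\delta\in(0,\delta_0)$ there is a finite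 or countable cover $\{U_1,U_2,\dots\}$ of $F$ by subsets of $X$ with $\delta^{1/\theta}\le|U_i|\le\delta$ for all $i$ and $\sum_i|U_i|^s\le\epsilon$. The lower $\theta$-intermediate dimension $\underline{\dim}_\theta F$ is the infimum of all $s\ge0$ such that for all $\epsilon>0$ and $\delta_0\in(0,1]$ there exist $\delta\in(0,\delta_0)$ and such a cover with $\delta^{1/\theta}\le|U_i|\le\delta$ for all $i$ and $\sum_i|U_i|^s\le\epsilon$. For $\theta=1$, $\overline{\dim}_1F:=\overline{\dim}_{\mathrm B}F$ and $\underline{\dim}_1F:=\underline{\dim}_{\mathrm B}F$. The Assouad dimension $\dim_{\mathrm A}F$ is the infimum of all $a$ for which there exists $C>0$ such that $N_r(B(x,R)\cap F)\le C(R/r)^a$ for all $x\in F$ and $0<r<R$. The lower dimension $\dim_{\mathrm L}F$ (for $F$ with more than one point) is the supremum of all $\lambda$ for which there exists $C>0$ such that $N_r(B(x,R)\cap F)\ge C(R/r)^\lambda$ for all $x\in F$ and $0<r<R\le|F|$. *)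

(* Defs.v *)
From mathcomp Require Import all_boot all_order all_algebra.
From mathcomp Require Import all_classical all_reals all_analysis.

Set Implicit Arguments.
Unset Strict Implicit.
Unset Printing Implicit Defensive.

Import Order.TTheory GRing.Theory Num.Theory.
Import numFieldTopology.Exports numFieldNormedType.Exports.

Local Open Scope classical_set_scope.
Local Open Scope ring_scope.

Section dimensions.
Context {R : realType} {X : metricType R}.
Implicit Types (F U : set X) (x : X) (r d s theta eps : R).

(* The supremum is taken in [0, +oo], so that the empty set has diameter 0. *)
Definition diam U : \bar R :=
  maxe 0%E (ereal_sup [set (mdist x y)%:E | x in U & y in U]).

Definition ball_cover d F (n : nat) : Prop :=
  exists c : 'I_n -> X,
    (forall i, F (c i)) /\ F `<=` \bigcup_(i in [set: 'I_n]) ball (c i) (d / 2).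

(* This is +oo when no finite cover exists. *)
Definition covering_number d F : \bar R :=
  ereal_inf [set n%:R%:E | n in ball_cover d F].

Definition totally_bounded_set F : Prop :=
  forall d, 0 < d -> (covering_number d F < +oo)%E.

Definition upper_box_dim F : \bar R :=
  limf_esup (fun d => lne (covering_number d F) / (- ln d)%:E)%E 0^'+.

Definition lower_box_dim F : \bar R :=
  limf_einf (fun d => lne (covering_number d F) / (- ln d)%:E)%E 0^'+.

(* The index set D is finite or countably infinite, as a subset of nat. *)
Definition intermediate_cover theta d s eps F : Prop :=
  exists (D : set nat) (U : nat -> set X),
    [/\ F `<=` \bigcup_(i in D) U i,
        forall i, D i -> ((d `^ theta^-1)%:E <= diam (U i) <= d%:E)%E &
        (\esum_(i in D) (diam (U i) `^ s) <= eps%:E)%E].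

Definition upper_intermediate_dim theta F : \bar R :=
  if theta == 1 then upper_box_dim F else
  ereal_inf [set s%:E | s in [set s | 0 <= s /\
    forall eps, 0 < eps -> exists2 d0, 0 < d0 <= 1 &
      forall d, 0 < d < d0 -> intermediate_cover theta d s eps F]].

Definition lower_intermediate_dim theta F : \bar R :=
  if theta == 1 then lower_box_dim F else
  ereal_inf [set s%:E | s in [set s | 0 <= s /\
    forall eps d0, 0 < eps -> 0 < d0 <= 1 ->
      exists2 d, 0 < d < d0 & intermediate_cover theta d s eps F]].

Definition assouad_dim F : \bar R :=
  ereal_inf [set a%:E | a in [set a : R | exists2 C : R, 0 < C &
    forall x r r', F x -> 0 < r < r' ->
      (covering_number r (ball x r' `&` F) <= (C * (r' / r) `^ a)%:E)%E]].

(* Meant for sets with more than one point; when F is a singleton no pair of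
   radii is admissible and the supremum is +oo. *)
Definition lower_dim F : \bar R :=
  ereal_sup [set l%:E | l in [set l : R | exists2 C : R, 0 < C &
    forall x r r', F x -> 0 < r < r' -> (r'%:E <= diam F)%E ->
      ((C * (r' / r) `^ l)%:E <= covering_number r (ball x r' `&` F))%E]].

End dimensions.

Definition uniformly_perfect {R : realType} (X : metricType R) : Prop :=
  exists2 c : R, 0 < c < 1 &
    forall (x : X) (r : R), 0 < r -> (r%:E < diam [set: X])%E ->
      (ball x r `\` ball x (c * r)) !=set0.

(* Main.v *)
Require Import Defs.
From mathcomp Require Import finmap.
From mathcomp Require Import all_boot all_order all_algebra.
From mathcomp Require Import all_classical all_reals all_analysis.
From mathcomp Require Import ring lra.

(* Write A, L, B for the Assouad, lower and box dimensions, and let s be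
   admissible for the theta-intermediate dimension. Given a cover U_i with
   d^(1/theta) <= |U_i| <= d and sum |U_i|^s <= 1, take a maximal packing of F
   by balls of radius r = d^g. A set U_i with |U_i| > r meets at most
   C (|U_i|/r)^a of them for a > A. A ball meeting only smaller sets satisfies
   sum |U_i|^l >= c r^l over the sets meeting it, for l < L, and these sets meet
   no other ball. Hence
     N_{8r}(F) <= C d^(a-s) r^(-a) + c^-1 d^((l-s)/theta) r^(-l),
   and choosing g to balance the two terms gives B <= a - (a-s)/g; let a -> A
   and l -> L. *)

Set Implicit Arguments.
Unset Strict Implicit.
Unset Printing Implicit Defensive.

Import Order.TTheory GRing.Theory Num.Theory.
Import numFieldTopology.Exports numFieldNormedType.Exports.
Local Open Scope classical_set_scope.
Local Open Scope ring_scope.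

(** After exchanging the sums, disjointness leaves each [f i] at most once. It is applied with [Q j]
    the covering sets that meet the j-th ball of a packing. *)
Lemma sum_disjoint_le (R : realType) (J I : finType) (A : pred J) (P : pred I)
    (Q : J -> pred I) (f : I -> R) :
  (forall i, P i -> 0 <= f i) ->
  (forall j i, A j -> Q j i -> P i) ->
  (forall j k i, A j -> A k -> Q j i -> Q k i -> j = k) ->
  \sum_(j | A j) \sum_(i | Q j i) f i <= \sum_(i | P i) f i.
Proof.
move=> f0 QP Qdisj.
rewrite (exchange_big_dep P)//=; apply: ler_sum => i Pi.
rewrite sumr_const -[leRHS]mulr1n.
apply: (ler_wpMn2l (f0 i Pi)).
apply/card_le1_eqP => j k; rewrite !unfold_in => /andP[Aj Qj] /andP[Ak Qk].
exact: esym (Qdisj j k i Aj Ak Qj Qk).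
Qed.

(** * Covering numbers and separated points *)

Section covering.
Context {R : realType} {X : metricType R}.
Implicit Types (E F : set X) (x y : X) (d r : R).

Lemma mdist_ball x d y : ball x d y <-> mdist x y < d.
Proof. by rewrite ballEmdist. Qed.

(** Greedy choice: fewer than [m] points of [E] cannot be the centres of a cover, so some point of
    [E] is at distance at least [d / 2] from all of them. *)
Lemma separated_points d E m :
  (forall n, ball_cover d E n -> (m <= n)%N) ->
  exists y : 'I_m -> X,
    (forall i, E (y i)) /\ (forall i j, i != j -> d / 2 <= mdist (y i) (y j)).
Proof.
move=> mE; suff: forall k, (k <= m)%N -> exists y : 'I_k -> X,
    (forall i, E (y i)) /\ (forall i j, i != j -> d / 2 <= mdist (y i) (y j)).
  exact.
elim=> [_|k IH km].
  by exists (fun i : 'I_0 => False_rect X (notF (ltn_ord i))); split => -[].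
have [y [yE ysep]] := IH (ltnW km).
have [z Ez zfar] : exists2 z, E z & forall i, ~ ball (y i) (d / 2) z.
  apply: contrapT => noz; suff /mE : ball_cover d E k by rewrite leqNgt km.
  exists y; split => // z Ez; apply: contrapT => zU; apply: noz; exists z => // i yz.
  by apply: zU; exists i.
pose y' (i : 'I_k.+1) := if unlift ord_max i is Some j then y j else z.
exists y'; rewrite /y'; split => [i|i j]; first by case: unliftP.
case: unliftP => [i' ->|->]; case: unliftP => [j' ->|->] ij.
- by apply: ysep; apply: contraNneq ij => ->.
- by rewrite leNgt; apply/negP => /mdist_ball /zfar.
- by rewrite metric_sym leNgt; apply/negP => /mdist_ball /zfar.
- by rewrite eqxx in ij.
Qed.

(** Pigeonhole: by the triangle inequality an open ball of radius [d / 2] contains at most one of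
    the separated points. *)
Lemma card_separated_le d E (J : finType) (T : {pred J}) (y : J -> X) n :
  (forall j, j \in T -> E (y j)) ->
  {in T &, forall i j, i != j -> d <= mdist (y i) (y j)} ->
  ball_cover d E n -> (#|T| <= n)%N.
Proof.
move=> TE Tsep [c [_ cov]].
have cover_idx j : exists i : option 'I_n,
    j \in T -> exists2 k, i = Some k & ball (c k) (d / 2) (y j).
  have [jT|_] := boolP (j \in T); last by exists None.
  by have [k _ ?] := cov _ (TE _ jT); exists (Some k) => _; exists k.
have [f fP] := choice cover_idx.
have [->|T0] := eqVneq #|T| 0%N; first by [].
have /card_gt0P[j0 j0T] : (0 < #|T|)%N by rewrite lt0n.
have [k0 _ _] := fP _ j0T.
pose g j := odflt k0 (f j).
rewrite -[leqRHS](card_ord n); apply: (@leq_card_in _ _ g) => i j iT jT.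
rewrite /g; have [k -> ki] := fP _ iT; have [k' -> kj] := fP _ jT => /= kk'.
apply/eqP/negP => /negP /(Tsep _ _ iT jT); rewrite leNgt => /negP; apply.
rewrite [d]splitr (le_lt_trans (metric_triangle _ (c k) _))// ltrD//.
  by rewrite metric_sym; apply/mdist_ball.
by rewrite kk'; apply/mdist_ball.
Qed.

Lemma covering_number_ge d E (m : nat) :
  (m%:R%:E <= covering_number d E)%E <-> forall n, ball_cover d E n -> (m <= n)%N.
Proof.
split=> [mE n cov|mE].
  rewrite -(ler_nat R) -lee_fin (le_trans mE)//.
  by apply: ereal_inf_lbound; exists n.
by apply: le_ereal_inf_tmp => _ [n /mE mn <-]; rewrite lee_fin ler_nat.
Qed.

(** The least integer [m >= z] works, every cover size being an integer at least [z]. This turns a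
    real bound into a number of points for [separated_points]. *)
Lemma nat_le_covering_number d E (z : R) :
  (z%:E <= covering_number d E)%E ->
  exists2 m : nat, z <= m%:R & forall n, ball_cover d E n -> (m <= n)%N.
Proof.
move=> zE.
have z_nat : exists m : nat, z <= m%:R.
  by exists (Num.bound `|z|); apply/ltW/(le_lt_trans (ler_norm z))/archi_boundP/normr_ge0.
case: (ex_minnP z_nat) => m zm m_min; exists m => // n cov; apply: m_min.
by rewrite -lee_fin (le_trans zE)//; apply: ereal_inf_lbound; exists n.
Qed.

End covering.

(** * Lower bounds on the content of balls *)

(* [u i] is an upper bound of the diameter of [U i], so that balls of a given
   radius can be used as covering sets; the lower bound [rho] does not enter the
   conclusion and only makes the induction on scales terminate. *)
Definition content_ge (R : realType) (X : metricType R) (F : set X) (l c : R) :=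
  forall (I : finType) (P : pred I) (U : I -> set X) (u : I -> R) (rho r : R) x,
    F x -> 0 < r -> (r%:E <= diam F)%E -> 0 < rho ->
    (forall i, P i -> rho <= u i) ->
    (forall i, P i -> forall p q, U i p -> U i q -> mdist p q <= u i) ->
    (forall z, F z -> ball x r z -> exists2 i, P i & U i z) ->
    c * r `^ l <= \sum_(i | P i) u i `^ l.

Section content.
Context {R : realType} {X : metricType R}.
Implicit Types (F : set X) (x : X).

(** Some covering set contains the centre and contributes 1 at exponent 0. This supplies the
    exponent when the lower dimension is zero or close to it. *)
Lemma content_ge0 F : content_ge F 0 1.
Proof.
move=> I P U u rho r x Fx r0 _ rho0 rhou _ cov.
have [i Pi _] := cov x Fx (ballxx _ r0).
rewrite (bigD1 i)//= !powRr0 mul1r lerDl.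
by apply: sumr_ge0 => j _; exact: powR_ge0.
Qed.

(* If no covering set has size at least [k * r], then [B(x, r)] contains
   [m >= k `^ (- l)] balls of radius [k * r] so far apart that no covering set
   meets two of them, and induction applies to each of these balls. The ratio [k]
   is so small that the gap between [l] and an admissible [l'] absorbs [C]. *)
Lemma content_ge_lower_dim F (l : R) : 0 <= l -> (l%:E < lower_dim F)%E ->
  exists2 c, 0 < c & content_ge F l c.
Proof.
move=> l0 /ereal_sup_gt[_ [l' [C C0 FC] <-]]; rewrite lte_fin => ll'.
(* [t] will be the ratio of the radii [r / 2] and [8 * (k * r)], where [k = 1 / (16 * t)]. Its size
   makes [C * t^l'] at least [(16 * t)^l = k^(- l)], the number of balls wanted; [2 <= t] gives
   [k <= 1/32]. *)
pose t := 2 + (16 `^ l / C) `^ (l' - l)^-1.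
have t2 : 2 <= t by rewrite lerDl powR_ge0.
have t0 : 0 < t by rewrite (lt_le_trans _ t2).
have tC : (16 * t) `^ l <= C * t `^ l'.
  have -> : t `^ l' = t `^ l * t `^ (l' - l).
    by rewrite -powRD ?(gt_eqF t0) ?implybT// addrC subrK.
  rewrite powRM ?(ltW t0)// [leLHS]mulrC mulrCA ler_wpM2l ?powR_ge0//.
  rewrite -ler_pdivrMl// mulrC.
  have {1}-> : 16 `^ l / C = ((16 `^ l / C) `^ (l' - l)^-1) `^ (l' - l).
    by rewrite -powRrM mulVf ?powRr1 ?divr_ge0 ?powR_ge0 ?ltW// subr_eq0 gt_eqF.
  rewrite ge0_ler_powR ?nnegrE ?subr_ge0 ?(ltW ll')//; first exact: powR_ge0.
    exact: ltW.
  by rewrite lerDr.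
pose k := (16 * t)^-1.
have k0 : 0 < k by rewrite invr_gt0 mulr_gt0.
have k32 : k <= 32^-1 by rewrite /k lef_pV2 ?posrE ?mulr_gt0//; lra.
exists (k `^ l); first exact: powR_gt0.
move=> I P U u rho r x Fx r0 rF rho0 rhou Uu cov.
(* Induction on [n]: passing from [r] to [k * r] at least halves the radius, which lowers [n]. Once
   [r <= rho], every covering set has size at least [k * r]. *)
have [n rn] : exists n : nat, r <= n.+1%:R * rho.
  exists (Num.bound (r / rho)); rewrite -ler_pdivrMr//.
  apply/ltW/(lt_le_trans (archi_boundP _)); first by rewrite divr_ge0 ?ltW.
  by rewrite ler_nat.
elim: n => [|n IH] in I P U u r x Fx r0 rF rhou Uu cov rn *.
  have [i Pi _] := cov x Fx (ballxx _ r0).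
  rewrite (bigD1 i)//= -[leLHS]addr0 lerD ?sumr_ge0//; last first.
    by move=> j _; exact: powR_ge0.
  rewrite -powRM ?(ltW k0) ?(ltW r0)// ge0_ler_powR ?nnegrE ?mulr_ge0 ?(ltW k0) ?(ltW r0)//.
    by rewrite (le_trans (ltW rho0))// rhou.
  rewrite mul1r in rn; rewrite (le_trans _ (rhou i Pi))// (le_trans _ rn)//; nra.
have [[i Pi kri]|small] := pselect (exists2 i, P i & k * r <= u i).
  rewrite (bigD1 i)//= -[leLHS]addr0 lerD ?sumr_ge0//; last first.
    by move=> j _; exact: powR_ge0.
  rewrite -powRM ?(ltW k0) ?(ltW r0)// ge0_ler_powR ?nnegrE ?mulr_ge0 ?(ltW k0) ?(ltW r0)//.
  by rewrite (le_trans (ltW rho0))// rhou.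
have {}small i : P i -> u i < k * r.
  by move=> Pi; rewrite ltNge; apply/negP => kri; apply: small; exists i.
have kr0 : 0 < k * r by rewrite mulr_gt0.
have [m km /separated_points[y [yE ysep]]] :
    exists2 m : nat, k^-1 `^ l <= m%:R &
      forall n, ball_cover (8 * (k * r)) (ball x (r / 2) `&` F) n -> (m <= n)%N.
  apply: nat_le_covering_number; apply: le_trans (FC x (8 * (k * r)) (r / 2) Fx _ _).
  - rewrite lee_fin /k invrK (_ : r / 2 / _ = t)//.
    by field; rewrite !gt_eqF.
  - by apply/andP; split; nra.
  - by rewrite (le_trans _ rF)// lee_fin; lra.
(* The centres are [4 * (k * r)] apart and the covering sets smaller than [k * r]; a set meeting two
   of the balls would bring their centres within [3 * (k * r)]. *)
pose Q j i := P i && `[<exists2 p, U i p & ball (y j) (k * r) p>].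
have QS j : k `^ l * (k * r) `^ l <= \sum_(i | Q j i) u i `^ l.
  have [/mdist_ball xy Fy] := yE j.
  apply: (IH I (Q j) U u (k * r) (y j)) => //.
  - by rewrite (le_trans _ rF)// lee_fin; nra.
  - by move=> i /andP[/rhou].
  - by move=> i /andP[/Uu].
  - move=> z Fz yz; have [|i Pi Uiz] := cov z Fz.
      apply/mdist_ball; rewrite (le_lt_trans (metric_triangle _ (y j) _))//.
      by move/mdist_ball : yz; nra.
    by exists i => //; rewrite /Q Pi; apply/asboolP; exists z.
  - rewrite (@le_trans _ _ (r / 2))//; first by nra.
    rewrite ler_pdivrMr// (le_trans rn)// -mulrA [rho * _]mulrC mulrA.
    by rewrite ler_pM2r// -natrM ler_nat muln2 -addnn addSn addnS ltnS leq_addr.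
apply: le_trans (sum_disjoint_le (A := predT) (Q := Q) _ _ _); first last.
- move=> j j' i _ _ /andP[Pi /asboolP[p Uip /mdist_ball yp]].
  move=> /andP[_ /asboolP[q Uiq /mdist_ball yq]]; apply/eqP/negP => /negP /ysep.
  have := metric_triangle (y j) p (y j'); have := metric_triangle p q (y j').
  by have := Uu i Pi p q Uip Uiq; have := small i Pi; rewrite (metric_sym q); lra.
- by move=> j i _ /andP[].
- by move=> i _; exact: powR_ge0.
(* The [m >= k^(- l)] balls make up for the factor [k^l] lost in passing to radius [k * r]. *)
apply: le_trans (ler_sum _ (fun j _ => QS j)).
rewrite sumr_const card_ord -[leRHS]mulr_natl powRM ?(ltW k0) ?(ltW r0)//.
rewrite -[leLHS]mul1r [leRHS]mulrA ler_wpM2r ?mulr_ge0 ?powR_ge0//.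
have : k^-1 `^ l * k `^ l = 1.
  have kV0 : 0 <= k^-1 by rewrite invr_ge0 ltW.
  by rewrite -powRM ?kV0 ?(ltW k0)// mulVf ?powR1// gt_eqF.
by move=> kk; rewrite -[leLHS]kk ler_wpM2r ?powR_ge0.
Qed.

End content.

(** * Counting packing balls against a cover *)

Section counting.
Context {R : realType} {X : metricType R}.
Implicit Types (F V : set X) (x : X).

(** The counted centres lie within [4 * v] of any one of them and are [4 * r] apart, so the Assouad
    bound at radii [4 * r < 4 * v], of ratio [v / r], limits their number. *)
Lemma card_meeting_le F (a C r v : R) (J : finType) (y : J -> X) V :
  0 < C -> 0 < r < v ->
  (forall x s s', F x -> 0 < s < s' ->
    (covering_number s (ball x s' `&` F) <= (C * (s' / s) `^ a)%:E)%E) ->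
  (forall j, F (y j)) ->
  (forall i j, i != j -> 4 * r <= mdist (y i) (y j)) ->
  (forall p q, V p -> V q -> mdist p q <= v) ->
  #|[pred j | `[<exists2 p, V p & ball (y j) r p>]]|%:R <= C * (v / r) `^ a.
Proof.
move=> C0 /andP[r0 rv] FC yF ysep Vv; set T := [pred j | _].
have TP j : j \in T -> exists2 p, V p & ball (y j) r p by move=> /asboolP.
have [->|/card_gt0P[j0 /TP[p0 Vp0 /mdist_ball yp0]]] := posnP #|T|.
  by rewrite mulr_ge0 ?powR_ge0// ltW.
have TE j : j \in T -> (ball (y j0) (4 * v) `&` F) (y j).
  move=> /TP[p Vp /mdist_ball yp]; split => //; apply/mdist_ball.
  have := metric_triangle (y j0) p0 (y j); have := metric_triangle p0 p (y j).
  by have := Vv p0 p Vp0 Vp; rewrite (metric_sym p); lra.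
have rv4 : 0 < 4 * r < 4 * v by lra.
have := FC (y j0) (4 * r) (4 * v) (yF j0) rv4.
rewrite (_ : 4 * v / (4 * r) = v / r); last by field; lra.
rewrite -lee_fin; apply: le_trans; apply/covering_number_ge => n.
apply: card_separated_le TE _ => i j _ _; exact: ysep.
Qed.

(** The two summands count the packing balls that meet a set larger than [r], and the others. As
    [rho <= u i <= delta], passing to exponent [s] costs [delta^(a - s)] from exponent [a] and
    [rho^(l - s)] from exponent [l]. *)
Lemma covering_number_le_cover F (a C l c s delta rho r : R)
    (I : finType) (P : pred I) (U : I -> set X) (u : I -> R) :
  0 < C -> 0 < c -> l <= s <= a ->
  (forall x s s', F x -> 0 < s < s' ->
    (covering_number s (ball x s' `&` F) <= (C * (s' / s) `^ a)%:E)%E) ->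
  content_ge F l c ->
  0 < r -> (r%:E <= diam F)%E -> 0 < rho ->
  (forall i, P i -> rho <= u i <= delta) ->
  (forall i, P i -> forall p q, U i p -> U i q -> mdist p q <= u i) ->
  (forall z, F z -> exists2 i, P i & U i z) ->
  (covering_number (8 * r) F < +oo)%E ->
  (covering_number (8 * r) F <=
    ((C * delta `^ (a - s) * r `^ (- a) + c^-1 * rho `^ (l - s) * r `^ (- l)) *
      \sum_(i | P i) u i `^ s)%:E)%E.
Proof.
move=> C0 c0 /andP[ls sa] FC Fc r0 rF rho0 urange Uu cov Nfin.
have u0 i : P i -> 0 < u i.
  by move=> /urange/andP[? _]; exact: lt_le_trans rho0 _.
have N0 : (0 <= covering_number (8 * r) F)%E.
  by apply: le_ereal_inf_tmp => _ [n _ <-]; rewrite lee_fin.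
have Nfin_num : covering_number (8 * r) F \is a fin_num by rewrite ge0_fin_numE.
have [|m Nm /separated_points[y [yF ysep]]] :=
  @nat_le_covering_number _ _ (8 * r) F (fine (covering_number (8 * r) F)).
  by rewrite fineK.
rewrite -(fineK Nfin_num) lee_fin (le_trans Nm)//.
have {}ysep i j : i != j -> 4 * r <= mdist (y i) (y j).
  by move=> /ysep; apply: le_trans; lra.
pose meets j i := `[<exists2 p, U i p & ball (y j) r p>].
pose large j := [exists i, [&& P i, r < u i & meets j i]].
have -> : m%:R = \sum_(j < m) 1 :> R by rewrite sumr_const card_ord.
(* Large balls are at most as many as the pairs of a ball and a set larger than [r] meeting it;
   exchanging the sums bounds the pairs set by set. *)
rewrite (bigID large)/= mulrDl lerD//.
  apply: (@le_trans _ _ (\sum_(j | large j) \sum_(i | [&& P i, r < u i & meets j i]) 1)).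
    apply: ler_sum => j /existsP[i Li]; rewrite (bigD1 i)//= lerDl.
    exact: sumr_ge0.
  rewrite (exchange_big_dep (fun i => P i && (r < u i)))/=; last first.
    by move=> j i _ /and3P[-> ->].
  rewrite mulr_sumr [leRHS](bigID (fun i => r < u i))/= -[leLHS]addr0.
  rewrite lerD ?sumr_ge0//; last first.
    by move=> i _; rewrite !mulr_ge0 ?powR_ge0// ltW.
  apply: ler_sum => i /andP[Pi ri]; rewrite sumr_const.
  have ri' : 0 < r < u i by rewrite r0.
  apply: le_trans (_ : #|[pred j | meets j i]|%:R <= _).
    rewrite ler_nat; apply: subset_leq_card; apply/fintype.subsetP => j.
    by rewrite !unfold_in => /andP[_ /and3P[_ _ mji]].
  apply: (le_trans (card_meeting_le C0 ri' FC yF ysep (Uu i Pi))).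
  have [_ ud] := andP (urange i Pi).
  have ui := u0 i Pi.
  rewrite powRM ?invr_ge0 ?(ltW r0) ?(ltW ui)// -powR_inv1 ?(ltW r0)// -powRrM mulN1r.
  rewrite !mulrA [leRHS]mulrAC ler_wpM2r ?powR_ge0// -mulrA ler_wpM2l ?(ltW C0)//.
  have -> : u i `^ a = u i `^ (a - s) * u i `^ s.
    by rewrite -powRD ?(gt_eqF ui) ?implybT// subrK.
  rewrite ler_wpM2r ?powR_ge0// ge0_ler_powR ?nnegrE ?subr_ge0// ?(ltW ui)//.
  exact: le_trans (ltW ui) ud.
(* A ball that is not large meets only sets of size at most [r]. With centres [4 * r] apart such a
   set meets no second ball, so the content bounds add up. *)
pose Q j i := P i && meets j i.
have QS j : c * r `^ l <= \sum_(i | Q j i) u i `^ l.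
  apply: (Fc I (Q j) U u rho r (y j)) => //.
  - by move=> i /andP[/urange/andP[]].
  - by move=> i /andP[/Uu].
  - move=> z Fz yz; have [i Pi Uiz] := cov z Fz.
    by exists i => //; rewrite /Q Pi; apply/asboolP; exists z.
have small j i : ~~ large j -> Q j i -> u i <= r.
  move=> /existsPn/(_ i) + /andP[Pi mji].
  by rewrite Pi mji andbT /= -leNgt.
have QSum : \sum_(j | ~~ large j) \sum_(i | Q j i) u i `^ l
    <= \sum_(i | P i) u i `^ l.
  apply: sum_disjoint_le.
  - by move=> i _; exact: powR_ge0.
  - by move=> j i _ /andP[].
  - move=> j j' i jS _ Qji; have := small j i jS Qji; move: Qji.
    move=> /andP[Pi /asboolP[p Uip /mdist_ball yp]] ur.
    move=> /andP[_ /asboolP[q Uiq /mdist_ball yq]]; apply/eqP/negP => /negP /ysep.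
    have := metric_triangle (y j) p (y j'); have := metric_triangle p q (y j').
    by have := Uu i Pi p q Uip Uiq; rewrite (metric_sym q); lra.
have uls : \sum_(i | P i) u i `^ l <= rho `^ (l - s) * \sum_(i | P i) u i `^ s.
  rewrite mulr_sumr; apply: ler_sum => i Pi.
  have ui := u0 i Pi; have [ru _] := andP (urange i Pi).
  have -> : u i `^ l = u i `^ (l - s) * u i `^ s.
    by rewrite -powRD ?(gt_eqF ui) ?implybT// subrK.
  rewrite ler_wpM2r ?powR_ge0// -(opprB s l) !powRN lef_pV2 ?posrE ?powR_gt0//.
  by rewrite ge0_ler_powR ?nnegrE ?subr_ge0 ?(ltW ui) ?(ltW rho0).
have crl : 0 < c * r `^ l by rewrite mulr_gt0 ?powR_gt0.
have -> : c^-1 * rho `^ (l - s) * r `^ (- l) * \sum_(i | P i) u i `^ s =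
    (c * r `^ l)^-1 * (rho `^ (l - s) * \sum_(i | P i) u i `^ s).
  by rewrite powRN invfM; ring.
rewrite ler_pdivlMl// (le_trans _ uls)// (le_trans _ QSum)// mulr_sumr.
by apply: ler_sum => j _; rewrite mulr1.
Qed.

End counting.

(** * Box dimensions from power bounds on covering numbers *)

Section box_dimension.
Context {R : realType} {X : metricType R}.
Implicit Types (F : set X) (b K d eta : R).

Lemma near_right0P (P : R -> Prop) :
  (\forall d \near 0^'+, P d) <-> exists2 e : R, 0 < e & forall d, 0 < d < e -> P d.
Proof.
split=> [|[e e0 eP]].
  move=> [e /= e0 eP]; exists e => // d /andP[d0 de].
  by apply: eP => //=; rewrite sub0r normrN gtr0_norm.
near=> d; apply: eP; apply/andP; split; near: d.
  exact: nbhs_right_gt.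
exact: nbhs_right_lt.
Unshelve. all: by end_near. Qed.

(** At small scales a constant factor in the covering number thus changes the logarithmic ratio by
    at most [eta]. *)
Lemma near_ln_le (z eta : R) : 0 < eta -> \forall d \near 0^'+, z <= eta * - ln d.
Proof.
move=> eta0; apply/near_right0P; exists (expR (- (z / eta))); first exact: expR_gt0.
move=> d /andP[d0 dz]; rewrite mulrC -ler_pdivrMr// lerNr.
by rewrite -[leRHS]expRK ler_ln ?posrE ?expR_gt0// ltW.
Qed.

Lemma covering_number_ge1 F d : F !=set0 -> (1 <= covering_number d F)%E.
Proof.
move=> [x Fx]; rewrite -[1%E]/(1%N%:R%:E); apply/covering_number_ge => -[|n]// [c [_ cov]].
by have [[]] := cov x Fx.
Qed.

Lemma box_ratio_le F K b eta d : F !=set0 -> 0 < K -> 0 < d < 1 ->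
  ln K <= eta * - ln d ->
  (covering_number d F <= (K * d `^ (- b))%:E)%E ->
  (lne (covering_number d F) / (- ln d)%:E <= (b + eta)%:E)%E.
Proof.
move=> F0 K0 d01 Keta NK; have [d0 d1] := andP d01.
have lnd : 0 < - ln d by rewrite oppr_gt0 ln_lt0.
have N1 := covering_number_ge1 d F0.
move: NK N1; case: (covering_number d F) => [n| |]//; rewrite !lee_fin => nK n1.
have n0 : 0 < n by rewrite (lt_le_trans _ n1).
rewrite lne_EFin// inver gt_eqF// -EFinM lee_fin ler_pdivrMr//.
have : ln n <= ln (K * d `^ (- b)) by rewrite ler_ln ?posrE ?mulr_gt0 ?powR_gt0.
by rewrite lnM ?posrE ?powR_gt0// ln_powR; lra.
Qed.

Lemma box_ratio_ge F K b eta d : F !=set0 -> 0 < K -> 0 < d < 1 ->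
  - ln K <= eta * - ln d ->
  (covering_number d F < +oo)%E ->
  ((K * d `^ (- b))%:E <= covering_number d F)%E ->
  ((b - eta)%:E <= lne (covering_number d F) / (- ln d)%:E)%E.
Proof.
move=> F0 K0 d01 Keta NF NK; have [d0 d1] := andP d01.
have lnd : 0 < - ln d by rewrite oppr_gt0 ln_lt0.
have N1 := covering_number_ge1 d F0.
move: NF NK N1; case: (covering_number d F) => [n| |]//.
rewrite !lee_fin => _ nK n1.
have n0 : 0 < n by rewrite (lt_le_trans _ n1).
rewrite lne_EFin// inver gt_eqF// -EFinM lee_fin ler_pdivlMr//.
have : ln (K * d `^ (- b)) <= ln n by rewrite ler_ln ?posrE ?mulr_gt0 ?powR_gt0.
by rewrite lnM ?posrE ?powR_gt0// ln_powR; lra.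
Qed.

Lemma upper_box_dim_le F K b : F !=set0 -> 0 < K ->
  (\forall d \near 0^'+, (covering_number d F <= (K * d `^ (- b))%:E)%E) ->
  (upper_box_dim F <= b%:E)%E.
Proof.
move=> F0 K0 NK; apply/lee_addgt0Pr => eta eta0.
rewrite /upper_box_dim limf_esupE; apply: ge_ereal_inf.
(* The limsup is an infimum over neighbourhoods of suprema; the set where the ratio obeys the bound
   is itself taken as the neighbourhood. *)
exists (ereal_sup [set lne (covering_number d F) / (- ln d)%:E | d in
  [set d | (lne (covering_number d F) / (- ln d)%:E <= (b + eta)%:E)%E]]%E).
  eexists; last by reflexivity.
  near=> d; apply: (@box_ratio_le F K) => //; near: d => //; last exact: near_ln_le.
  by apply/near_right0P; exists 1.
by apply: ge_ereal_sup => _ [d ? <-].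
Unshelve. all: by end_near. Qed.

Lemma lower_box_dim_le F K b : F !=set0 -> 0 < K ->
  (forall d0, 0 < d0 -> exists2 d, 0 < d < d0 &
    (covering_number d F <= (K * d `^ (- b))%:E)%E) ->
  (lower_box_dim F <= b%:E)%E.
Proof.
move=> F0 K0 NK; apply/lee_addgt0Pr => eta eta0.
rewrite /lower_box_dim limf_einfE; apply: ge_ereal_sup => _ [V V0 <-].
have : \forall d \near 0^'+, [/\ V d, ln K <= eta * - ln d & d < 1].
  near=> d; split; near: d => //; first exact: near_ln_le.
  exact: nbhs_right_lt.
move=> /near_right0P[e e0 eP]; have [d /[dup] d0e /eP[Vd Kd d1] Nd] := NK e e0.
apply: ge_ereal_inf; exists (lne (covering_number d F) / (- ln d)%:E)%E; first by exists d.
by apply: (@box_ratio_le F K) => //; rewrite d1 andbT; case/andP: d0e.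
Unshelve. all: by end_near. Qed.

Lemma lower_box_dim_ge F K b : F !=set0 -> totally_bounded_set F -> 0 < K ->
  (\forall d \near 0^'+, ((K * d `^ (- b))%:E <= covering_number d F)%E) ->
  (b%:E <= lower_box_dim F)%E.
Proof.
move=> F0 Ftb K0 NK; apply/lee_subgt0Pr => eta eta0.
rewrite /lower_box_dim limf_einfE; apply: le_ereal_sup_tmp.
exists (ereal_inf [set lne (covering_number d F) / (- ln d)%:E | d in
  [set d | ((b - eta)%:E <= lne (covering_number d F) / (- ln d)%:E)%E]]%E).
  eexists; last by reflexivity.
  near=> d; apply: (@box_ratio_ge F K) => //; [| |apply: Ftb|]; near: d => //.
  - by apply/near_right0P; exists 1.
  - exact: near_ln_le.
  - exact: nbhs_right_gt.
by apply: le_ereal_inf_tmp => _ [d ? <-].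
Unshelve. all: by end_near. Qed.

Lemma lower_le_upper_box_dim F : (lower_box_dim F <= upper_box_dim F)%E.
Proof.
rewrite /lower_box_dim /upper_box_dim limf_einfE limf_esupE.
apply: ge_ereal_sup => _ [V V0 <-]; apply: le_ereal_inf_tmp => _ [W W0 <-].
have [d [Vd Wd]] := filter_ex (filterI V0 W0).
apply: (@le_trans _ _ (lne (covering_number d F) / (- ln d)%:E)%E).
  by apply: ereal_inf_lbound; exists d.
by apply: ereal_sup_ubound; exists d.
Qed.

End box_dimension.

(** * Consequences of an intermediate cover *)

Section covers.
Context {R : realType} {X : metricType R}.
Implicit Types (F : set X) (x : X).

Lemma mdist_le_diam F p q : F p -> F q -> ((mdist p q)%:E <= diam F)%E.
Proof.
by move=> Fp Fq; rewrite /diam le_max ereal_sup_ubound ?orbT//; exists p => //; exists q.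
Qed.

Lemma esum_ge_fset (D : set nat) (v : nat -> R) (B : {fset nat}) :
  [set` B] `<=` D ->
  ((\sum_(i <- B) v i)%:E <= \esum_(i in D) (v i)%:E)%E.
Proof.
move=> BD; apply: esum_ge; exists [set` B]; first by split => //; exact: finite_fset.
by rewrite fsbig_finite ?finite_fset// set_fsetK sumEFin.
Qed.

(* Countable covers are automatically finite, since the diameters are bounded
   away from 0 and have a finite [s]-sum. *)
Lemma intermediate_cover_finite F (theta d s eps : R) : 0 < d -> 0 <= s ->
  intermediate_cover theta d s eps F ->
  exists (I : finType) (U : I -> set X) (u : I -> R),
    [/\ forall i, d `^ theta^-1 <= u i <= d,
        forall i p q, U i p -> U i q -> mdist p q <= u i,
        forall z, F z -> exists i, U i z &
        \sum_i u i `^ s <= eps].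
Proof.
move=> d0 s0 [D [U [cov dU sumU]]].
pose v i := fine (diam (U i)).
have vE i : D i -> diam (U i) = (v i)%:E.
  move=> /dU /andP[lo hi]; rewrite /v fineK// fin_real//.
  by rewrite (lt_le_trans _ lo) ?ltNyr// (le_lt_trans hi) ?ltry.
have vd i : D i -> d `^ theta^-1 <= v i <= d.
  by move=> Di; have := dU i Di; rewrite vE// !lee_fin.
have sumB (B : {fset nat}) : [set` B] `<=` D -> \sum_(i <- B) v i `^ s <= eps.
  move=> BD; rewrite -lee_fin (le_trans _ sumU)//.
  rewrite (eq_esum (b := fun i => (v i `^ s)%:E)); first exact: esum_ge_fset.
  by move=> i /vE ->; rewrite poweR_EFin.
(* [w] bounds every term from below, so more than [|eps| / w] indices would push the sum above
   [eps]. *)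
pose w := (d `^ theta^-1) `^ s.
have w0 : 0 < w by rewrite powR_gt0// powR_gt0.
have vw i : D i -> w <= v i `^ s.
  move=> /vd/andP[lo _]; rewrite ge0_ler_powR ?nnegrE ?powR_ge0//.
  exact: le_trans (powR_ge0 _ _) lo.
have finD : finite_set D.
  apply: contrapT => /(@infinite_set_fset _ _ (Num.bound (`|eps| / w)))[B BD nB].
  have := sumB B BD; apply/negP; rewrite -ltNge.
  apply: (@lt_le_trans _ _ ((size B)%:R * w)); last first.
    rewrite mulr_natl -[size B]count_predT -iter_addr_0 -big_const_seq.
    rewrite big_seq [leRHS]big_seq.
    by apply: ler_sum => i iB; apply: vw; exact: BD.
  rewrite -ltr_pdivrMr// (@lt_le_trans _ _ (Num.bound (`|eps| / w))%:R) ?ler_nat//.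
  apply: le_lt_trans (archi_boundP _); last by rewrite divr_ge0// ltW.
  by rewrite ler_pM2r ?invr_gt0// ler_norm.
pose B := fset_set D.
have BD i : i \in B -> D i by rewrite in_fset_set// inE.
exists B, (fun i => U (val i)), (fun i => v (val i)); split.
- by move=> i; apply/vd/BD/valP.
- move=> i p q Up Uq; rewrite -lee_fin -vE; last exact/BD/valP.
  exact: mdist_le_diam.
- move=> z /cov[i Di Uz]; have iB : i \in B by rewrite in_fset_set// inE.
  by exists [` iB]%fset.
- rewrite -(big_seq_fsetE _ B xpredT (fun i => v i `^ s))/=.
  by apply: sumB => i /= /BD.
Qed.

(** If [s < l], sizes below 1 make the [l]-sum at most the [s]-sum, hence at most half of the
    content bound [c * r0^l]: a contradiction. *)
Lemma intermediate_cover_exponent F (l c s theta d r0 : R) : F !=set0 ->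
  0 < r0 -> (r0%:E <= diam F)%E -> 0 <= s -> 0 < c -> content_ge F l c ->
  0 < d < 1 -> intermediate_cover theta d s (c * r0 `^ l / 2) F -> l <= s.
Proof.
move=> [x Fx] r00 rF s0 c0 Fc /andP[d0 d1] /(intermediate_cover_finite d0 s0).
move=> [I [U [u [ud Uu cov sumu]]]]; rewrite leNgt; apply/negP => sl.
have : c * r0 `^ l <= \sum_i u i `^ l.
  apply: (Fc I predT U u (d `^ theta^-1) r0 x) => //; first exact: powR_gt0.
  - by move=> i _; case/andP: (ud i).
  - by move=> i _; exact: Uu.
  - by move=> z /cov[i Uz] _; exists i.
apply/negP; rewrite -ltNge (@le_lt_trans _ _ (c * r0 `^ l / 2))//; last first.
  by rewrite ltr_pdivrMr// ltr_pMr ?mulr_gt0 ?powR_gt0// ltr1n.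
apply: le_trans sumu; apply: ler_sum => i _; apply: ger_powR; last exact: ltW.
have /andP[lo hi] := ud i.
by rewrite (lt_le_trans (powR_gt0 _ d0) lo) (le_trans hi (ltW d1)).
Qed.

(* The scale [d `^ g] balances the two terms of [covering_number_le_cover] for
   [delta = d] and [rho = d `^ theta^-1]. *)
Lemma intermediate_cover_covering_number F (a C l c s theta d : R)
    (g := (a - s + (s - l) / theta) / (a - l)) (b := a - (a - s) / g) :
  0 < C -> 0 < c -> 0 <= l <= s -> s < a -> 0 < theta ->
  (forall x r r', F x -> 0 < r < r' ->
    (covering_number r (ball x r' `&` F) <= (C * (r' / r) `^ a)%:E)%E) ->
  content_ge F l c -> totally_bounded_set F ->
  0 < d -> ((d `^ g)%:E <= diam F)%E ->
  intermediate_cover theta d s 1 F ->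
  (covering_number (8 * d `^ g) F <=
    (((C + c^-1) * 8 `^ b) * (8 * d `^ g) `^ (- b))%:E)%E.
Proof.
move=> C0 c0 /andP[l0 ls] sa th0 FC Fc Ftb d0 dF.
have s0 := le_trans l0 ls.
move=> /(intermediate_cover_finite d0 s0)[I [U [u [ud Uu cov sumu]]]].
have al0 : 0 < a - l by lra.
have g0 : 0 < g.
  by rewrite divr_gt0// ltr_pwDl ?subr_gt0// divr_ge0 ?subr_ge0// ltW.
have dg0 : 0 < d `^ g by exact: powR_gt0.
(* Both powers of [d] will equal [- (g * b)]: [gb] handles [a - s - g * a], and [gal] identifies
   [(l - s) / theta - g * l] with it. The factor [8^b] in the constant offsets the 8 in the scale
   [8 * d^g]. *)
have gb : g * b = g * a - (a - s) by rewrite /b; field; rewrite gt_eqF.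
have gal : g * (a - l) = a - s + (s - l) / theta by rewrite /g mulfVK// gt_eqF.
have lsa : l <= s <= a by rewrite ls ltW.
have := covering_number_le_cover (P := predT) C0 c0 lsa FC Fc dg0 dF
  (powR_gt0 theta^-1 d0) (fun i _ => ud i) (fun i _ => Uu i) _ _.
move=> /(_ _ (Ftb _ _)) H; apply: le_trans (H _ _) _.
- by move=> z /cov[i Uz]; exists i.
- by rewrite mulr_gt0.
rewrite lee_fin powRM ?(ltW dg0)//.
have dD e f : d `^ e * d `^ f = d `^ (e + f) by rewrite powRD// (gt_eqF d0) implybT.
rewrite -!mulrA -!powRrM !dD.
have -> : a - s + g * - a = - (g * b) by rewrite gb; ring.
have -> : theta^-1 * (l - s) + g * - l = - (g * b).
  rewrite gb; move: gal; rewrite mulrBr => gal.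
  have -> : theta^-1 * (l - s) = - ((s - l) / theta) by ring.
  lra.
have -> : 8 `^ b * (8 `^ (- b) * d `^ (g * - b)) = d `^ (- (g * b)).
  by rewrite mulrA -powRD ?pnatr_eq0 ?implybT// subrr powRr0 mul1r mulrN.
rewrite -mulrDl -[leRHS]mulr1 ler_wpM2l// mulr_ge0 ?powR_ge0// addr_ge0 ?ltW//.
by rewrite invr_gt0.
Qed.

End covers.

(** * Real inequalities and the limit of exponents *)

Section real_bounds.
Context {R : realType}.
Implicit Types (A B L a b l s theta : R).

(** The fraction is the root in [s] of [(A - B) * (s - L) = theta * (B - L) * (A - s)], a linear
    equation whose leading coefficient is the positive denominator. *)
Lemma exponent_le theta A L B s : 0 < theta -> L < A -> L <= B <= A ->
  (A - B) * (s - L) >= theta * (B - L) * (A - s) ->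
  (theta * A * (B - L) + L * (A - B)) / (theta * (B - L) + (A - B)) <= s.
Proof.
move=> th0 LA /andP[LB BA] H.
have D0 : 0 < theta * (B - L) + (A - B) by nra.
by rewrite ler_pdivrMr//; nra.
Qed.

(** From [A] on, the two sides compared in [exponent_le] lie on opposite sides of 0. *)
Lemma exponent_le_top theta A L B s : 0 < theta -> L < A -> L <= B <= A -> A <= s ->
  (theta * A * (B - L) + L * (A - B)) / (theta * (B - L) + (A - B)) <= s.
Proof.
move=> th0 LA /[dup] LBA /andP[LB BA] As; apply: exponent_le => //.
apply: (@le_trans _ _ 0); last by rewrite mulr_ge0 ?subr_ge0// (le_trans LB)// (le_trans BA).
by rewrite mulr_ge0_le0 ?subr_le0// mulr_ge0 ?subr_ge0// ltW.
Qed.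

(** Clearing denominators in the bound from the balanced scale gives the inequality of [exponent_le]
    with [a], [l] for [A], [L]. *)
Lemma balanced_exponent_le theta a l B s : 0 < theta -> l <= s -> s < a ->
  B <= a - (a - s) / ((a - s + (s - l) / theta) / (a - l)) ->
  theta * (B - l) * (a - s) <= (a - B) * (s - l).
Proof.
move=> th0 ls sa.
have D0 : 0 < theta * (a - s) + (s - l) by rewrite ltr_pwDl ?mulr_gt0 ?subr_gt0// subr_ge0.
have -> : (a - s) / ((a - s + (s - l) / theta) / (a - l)) =
    theta * (a - s) * (a - l) / (theta * (a - s) + (s - l)).
  field; do ?[apply/andP; split]; lra.
rewrite lerBrDl -lerBrDr ler_pdivrMr// => H; nra.
Qed.

Lemma approx_exponent_le theta A L B s : 0 < theta -> L < A -> L <= B <= A ->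
  s < A ->
  (forall e, 0 < e -> exists a l, [/\ A <= a < A + e, L - e < l <= L, l <= s &
    B <= a - (a - s) / ((a - s + (s - l) / theta) / (a - l))]) ->
  (theta * A * (B - L) + L * (A - B)) / (theta * (B - L) + (A - B)) <= s.
Proof.
move=> th0 LA /[dup] LBA /andP[LB BA] sA H.
apply: exponent_le => //; apply/ler_addgt0Pr => eta eta0.
(* For [e <= 1], replacing [(A - B) * (s - L)] by [(A - B + e) * (s - L + e)] adds
   [e * (A - B + (s - L) + e)], which is at most [e * M <= eta]. *)
pose M := A - B + `|s - L| + 1.
have M0 : 0 < M by rewrite ltr_wpDl// addr_ge0// subr_ge0.
pose e := Num.min 1 (eta / M).
have e0 : 0 < e by rewrite lt_min ltr01 divr_gt0.
have e1 : e <= 1 by rewrite ge_min lexx.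
have eM : e * M <= eta by rewrite -ler_pdivlMr// ge_min lexx orbT.
have [a [l [/andP[Aa aA] /andP[Ll lL] ls Ble]]] := H e e0.
have := balanced_exponent_le th0 ls (lt_le_trans sA Aa) Ble.
have sL := ler_norm (s - L).
have h1 : theta * (B - L) * (A - s) <= theta * (B - l) * (a - s).
  by apply: ler_pM; rewrite ?mulr_ge0 ?ler_wpM2l ?subr_ge0 ?(ltW th0) ?(ltW sA)//; lra.
have h2 : (a - B) * (s - l) <= (A - B + e) * (s - L + e).
  by apply: ler_pM; rewrite ?subr_ge0//; lra.
have h3 : e * (A - B + (s - L) + e) <= e * M by rewrite ler_wpM2l ?(ltW e0)// /M; lra.
nra.
Qed.

Lemma exponent1 A L B : L < A ->
  (1 * A * (B - L) + L * (A - B)) / (1 * (B - L) + (A - B)) = B.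
Proof. by move=> LA; field; lra. Qed.

End real_bounds.

(** * Admissible exponents and comparison of the dimensions *)

Section dimension_bounds.
Context {R : realType} {X : metricType R}.
Implicit Types (F : set X) (x : X).

Lemma lower_dim_ge0 F : (0 <= lower_dim F)%E.
Proof.
apply: ereal_sup_ubound; exists 0 => //; exists 1 => // x r r' Fx /andP[r0 rr'] _.
rewrite powRr0 mulr1; apply: covering_number_ge1; exists x; split => //.
by apply: ballxx; exact: lt_trans rr'.
Qed.

(** If no positive radius is at most the diameter, the condition on the exponent is vacuous and the
    supremum is infinite. *)
Lemma diam_gt0 F : (lower_dim F < +oo)%E -> exists2 r : R, 0 < r & (r%:E <= diam F)%E.
Proof.
move=> Llt; apply: contrapT => nor.
suff LE : lower_dim F = +oo%E by rewrite LE ltxx in Llt.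
apply: eq_infty => M; apply: ereal_sup_ubound; exists M => //; exists 1 => // x r r' _.
move=> /andP[r0 rr'] r'F; exfalso; apply: nor; exists r' => //.
exact: lt_trans rr'.
Qed.

Lemma content_exponents F (L e : R) : lower_dim F = L%:E -> 0 < e ->
  exists l c, [/\ 0 <= l, L - e < l <= L, 0 < c & content_ge F l c].
Proof.
move=> LE e0; have L0 : 0 <= L by rewrite -lee_fin -LE lower_dim_ge0.
(* If [L <= e / 2], the exponent 0 is close enough to [L]; otherwise [L - e / 2] is positive and
   strictly below the lower dimension. *)
have [Le|eL] := leP L (e / 2).
  by exists 0, 1; split => //; [apply/andP; split; lra|exact: content_ge0].
have [||c c0 Fc] := @content_ge_lower_dim _ _ F (L - e / 2).
- by lra.
- by rewrite LE lte_fin; lra.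
- by exists (L - e / 2), c; split => //; lra.
Qed.

Lemma assouad_exponents F (A e : R) : assouad_dim F = A%:E -> 0 < e ->
  exists a C, [/\ A <= a < A + e, 0 < C &
    forall x r r', F x -> 0 < r < r' ->
      (covering_number r (ball x r' `&` F) <= (C * (r' / r) `^ a)%:E)%E].
Proof.
move=> AE e0; have : (assouad_dim F < (A + e)%:E)%E by rewrite AE lte_fin ltrDl.
move=> /ereal_inf_lt[_ [a [C C0 FC] <-]]; rewrite lte_fin => aA.
exists a, C; split => //; rewrite aA andbT -lee_fin -AE.
by apply: ereal_inf_lbound; exists a => //; exists C.
Qed.

Lemma totally_bounded_ball F : F !=set0 -> totally_bounded_set F ->
  exists x r, [/\ F x, 0 < r & F `<=` ball x r].
Proof.
move=> [x Fx] /(_ 1 ltr01)/ereal_inf_lt[_ [n [c [_ cov]] _] _].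
exists x, (1 + \sum_i mdist x (c i)); split => //.
  by rewrite ltr_wpDr// sumr_ge0// => i _; exact: mdist_ge0.
move=> z /cov[i _ /mdist_ball cz]; apply/mdist_ball.
rewrite (le_lt_trans (metric_triangle x (c i) z))// addrC ltr_leD//; first by lra.
by rewrite (bigD1 i)//= lerDl sumr_ge0// => j _; exact: mdist_ge0.
Qed.

(** [F] lies in a single ball, and the Assouad bound with that fixed outer radius is a constant
    times [d^(- a)]. *)
Lemma upper_box_dim_le_assouad F (A : R) : F !=set0 -> totally_bounded_set F ->
  assouad_dim F = A%:E -> (upper_box_dim F <= A%:E)%E.
Proof.
move=> F0 Ftb AE; apply/lee_addgt0Pr => e e0.
have [a [C [/andP[_ aA] C0 FC]]] := assouad_exponents AE e0.
have [x [r [Fx r0 Fr]]] := totally_bounded_ball F0 Ftb.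
apply: (@le_trans _ _ a%:E); last by rewrite lee_fin ltW.
apply: (@upper_box_dim_le _ _ F (C * r `^ a)) => //; first by rewrite mulr_gt0 ?powR_gt0.
apply/near_right0P; exists r => // d /andP[d0 dr].
rewrite powRN -mulrA -powR_inv1 ?powR_ge0// -powRrM mulrN1.
have := FC x d r Fx; rewrite d0 dr (setIidr Fr) => /(_ isT).
by rewrite powRM ?invr_ge0 ?(ltW r0) ?(ltW d0)// -powR_inv1 ?(ltW d0)// -powRrM mulN1r.
Qed.

(** A cover by [n] balls of radius [d / 2] has sizes at most [d], so the content bound reads
    [c * r^l <= n * d^l]. *)
Lemma lower_dim_le_lower_box F (L : R) : F !=set0 -> totally_bounded_set F ->
  lower_dim F = L%:E -> (L%:E <= lower_box_dim F)%E.
Proof.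
move=> F0 Ftb LE; apply/lee_subgt0Pr => e e0.
have [r r0 rF] : exists2 r : R, 0 < r & (r%:E <= diam F)%E.
  by apply: diam_gt0; rewrite LE ltry.
have [l [c [l0 /andP[Ll _] c0 Fc]]] := content_exponents LE e0.
apply: (@le_trans _ _ l%:E); first by rewrite lee_fin ltW.
apply: (@lower_box_dim_ge _ _ F (c * r `^ l)) => //; first by rewrite mulr_gt0 ?powR_gt0.
apply/near_right0P; exists 1 => // d /andP[d0 _].
apply: le_ereal_inf_tmp => _ [n [y [_ cov]] <-]; rewrite lee_fin.
rewrite powRN ler_pdivrMr ?powR_gt0//; have [x Fx] := F0.
have := Fc 'I_n predT (fun i => ball (y i) (d / 2)) (fun=> d) d r x Fx r0 rF d0.
rewrite sumr_const card_ord mulr_natl; apply => //.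
  move=> i _ p q /mdist_ball yp /mdist_ball yq.
  by have := metric_triangle p (y i) q; rewrite (metric_sym p (y i)); lra.
by move=> z /cov[i _ yz] _; exists i.
Qed.

End dimension_bounds.

(** * From box bounds to intermediate dimensions *)

Section intermediate_dimensions.
Context {R : realType} {X : metricType R}.
Implicit Types (F : set X) (theta s : R).

(* The last hypothesis abstracts over the upper and lower box dimensions. *)
Lemma intermediate_exponent_le F (A L B theta s : R) :
  F !=set0 -> totally_bounded_set F ->
  assouad_dim F = A%:E -> lower_dim F = L%:E -> L < A -> L <= B <= A ->
  0 < theta -> 0 <= s ->
  (forall eps, 0 < eps ->
    exists2 d, 0 < d < 1 & intermediate_cover theta d s eps F) ->
  (forall K g b r0, 0 < K -> 0 < g -> 0 < r0 ->
    (forall d, 0 < d -> d `^ g <= r0 -> intermediate_cover theta d s 1 F ->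
      (covering_number (8 * d `^ g) F <= (K * (8 * d `^ g) `^ (- b))%:E)%E) ->
    B <= b) ->
  (theta * A * (B - L) + L * (A - B)) / (theta * (B - L) + (A - B)) <= s.
Proof.
move=> F0 Ftb AE LE LA LBA theta0 s0 covs boxB.
have [r0 r00 r0F] : exists2 r : R, 0 < r & (r%:E <= diam F)%E.
  by apply: diam_gt0; rewrite LE ltry.
have [As|sA] := leP A s; first exact: exponent_le_top.
apply: approx_exponent_le => // e e0.
have [a [C [/andP[Aa aA] C0 FC]]] := assouad_exponents AE e0.
have [l [c [l0 lL c0 Fc]]] := content_exponents LE e0.
have ls : l <= s.
  have [|d d01 covd] := covs (c * r0 `^ l / 2).
    by rewrite divr_gt0// mulr_gt0// powR_gt0.
  exact: (intermediate_cover_exponent F0 r00 r0F s0 c0 Fc d01 covd).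
exists a, l; split; rewrite ?Aa//.
have sa : s < a by exact: lt_le_trans Aa.
set g := (X in _ / X); set b := a - _.
have g0 : 0 < g.
  rewrite divr_gt0// ?subr_gt0 ?(le_lt_trans ls)// ltr_pwDl ?subr_gt0//.
  by rewrite divr_ge0 ?subr_ge0// ltW.
apply: (boxB ((C + c^-1) * 8 `^ b) g b r0) => //.
  by rewrite mulr_gt0 ?powR_gt0// addr_gt0 ?invr_gt0.
move=> d d0 dr0 covd.
apply: (intermediate_cover_covering_number C0 c0 _ sa) => //; first by rewrite l0.
by rewrite (le_trans _ r0F)// lee_fin.
Qed.

(** The substitution [d -> 8 * d^g] is a bijection of the positive reals, so it reaches every small
    scale. *)
Lemma upper_box_dim_le_powR F (K g b r0 d0 : R) : F !=set0 ->
  0 < K -> 0 < g -> 0 < r0 -> 0 < d0 ->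
  (forall d, 0 < d < d0 -> d `^ g <= r0 ->
    (covering_number (8 * d `^ g) F <= (K * (8 * d `^ g) `^ (- b))%:E)%E) ->
  (upper_box_dim F <= b%:E)%E.
Proof.
move=> F0 K0 g0 r00 d00 NK; apply: (upper_box_dim_le F0 K0).
apply/near_right0P; exists (8 * Num.min (d0 `^ g) r0).
  by rewrite mulr_gt0// lt_min powR_gt0.
move=> d /andP[d_gt0]; rewrite mulrC -ltr_pdivrMr// lt_min => /andP[dd0 dr0].
have d8 : 0 < d / 8 by rewrite divr_gt0.
pose d' := (d / 8) `^ g^-1.
have d'g : d' `^ g = d / 8 by rewrite -powRrM mulVf ?powRr1 ?(ltW d8)// gt_eqF.
have -> : d = 8 * d' `^ g by rewrite d'g; field.
apply: NK; last by rewrite d'g ltW.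
rewrite powR_gt0//= ltNge; apply/negP => dd'.
move: dd0; apply/negP; rewrite -leNgt -d'g.
by rewrite ge0_ler_powR ?nnegrE ?powR_ge0 ?(ltW g0) ?(ltW d00).
Qed.

(** [P] marks the scales that admit a cover. They are arbitrarily small, hence so are their images
    [8 * d^g], which is enough for a liminf. *)
Lemma lower_box_dim_le_powR F (K g b r0 : R) (P : R -> Prop) : F !=set0 ->
  0 < K -> 0 < g -> 0 < r0 ->
  (forall d0, 0 < d0 <= 1 -> exists2 d, 0 < d < d0 & P d) ->
  (forall d, 0 < d -> d `^ g <= r0 -> P d ->
    (covering_number (8 * d `^ g) F <= (K * (8 * d `^ g) `^ (- b))%:E)%E) ->
  (lower_box_dim F <= b%:E)%E.
Proof.
move=> F0 K0 g0 r00 exP NK; apply: (lower_box_dim_le F0 K0) => d1 d10.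
pose m := Num.min (d1 / 8) r0.
have m0 : 0 < m by rewrite lt_min divr_gt0.
have [|d /andP[d0 dm] Pd] := exP (Num.min 1 (m `^ g^-1)).
  by rewrite lt_min ltr01 powR_gt0//= ge_min lexx.
have dgm : d `^ g < m.
  have -> : m = (m `^ g^-1) `^ g by rewrite -powRrM mulVf ?powRr1 ?(ltW m0)// gt_eqF.
  rewrite gt0_ltr_powR ?nnegrE ?powR_ge0 ?(ltW d0)//.
  by move: dm; rewrite lt_min => /andP[].
move: dgm; rewrite lt_min => /andP[dg1 dgr].
exists (8 * d `^ g); first by rewrite mulr_gt0 ?powR_gt0//= mulrC -ltr_pdivlMr.
by apply: NK => //; exact: ltW.
Qed.

End intermediate_dimensions.

Theorem corollary3p14 (R : realType) (X : metricType R) (F : set X)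
    (X_perfect : uniformly_perfect X)
    (X_nontrivial : exists x y : X, x <> y)
    (F_nonempty : F !=set0)
    (F_totally_bounded : totally_bounded_set F)
    (dimL_lt_dimA : (lower_dim F < assouad_dim F)%E)
    (dimA_fin : (assouad_dim F < +oo)%E)
    (theta : R) (theta_range : 0 < theta <= 1) :
  ((theta%:E * assouad_dim F * (upper_box_dim F - lower_dim F)
      + lower_dim F * (assouad_dim F - upper_box_dim F))
    / (theta%:E * (upper_box_dim F - lower_dim F)
      + (assouad_dim F - upper_box_dim F))
    <= upper_intermediate_dim theta F)%E
  /\
  ((theta%:E * assouad_dim F * (lower_box_dim F - lower_dim F)
      + lower_dim F * (assouad_dim F - lower_box_dim F))
    / (theta%:E * (lower_box_dim F - lower_dim F)
      + (assouad_dim F - lower_box_dim F))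
    <= lower_intermediate_dim theta F)%E.
Proof.
have /andP[theta0 theta1] := theta_range.
have L0 := lower_dim_ge0 F.
have LE : lower_dim F = (fine (lower_dim F))%:E.
  by rewrite fineK// ge0_fin_numE// (lt_trans dimL_lt_dimA).
have AE : assouad_dim F = (fine (assouad_dim F))%:E.
  by rewrite fineK// ge0_fin_numE// (le_trans L0)// ltW.
set L := fine (lower_dim F) in LE; set A := fine (assouad_dim F) in AE.
have LlA : L < A by rewrite -lte_fin -LE -AE.
have LlB := lower_dim_le_lower_box F_nonempty F_totally_bounded LE.
have BuA := upper_box_dim_le_assouad F_nonempty F_totally_bounded AE.
have lu := lower_le_upper_box_dim F.
(* Lying between [L] and [A], both box dimensions are finite, which reduces the formula to real
   arithmetic. *)
have real_box D : (L%:E <= D)%E -> (D <= A%:E)%E -> D = (fine D)%:E.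
  move=> LD DA; rewrite fineK// fin_real// (lt_le_trans (ltNyr L) LD).
  exact: le_lt_trans DA (ltry A).
have BuE := real_box _ (le_trans LlB lu) BuA.
have BlE := real_box _ LlB (le_trans lu BuA).
set Bu := fine (upper_box_dim F) in BuE; set Bl := fine (lower_box_dim F) in BlE.
rewrite BuE BlE in LlB BuA lu; rewrite !lee_fin in LlB BuA lu.
have real_formula B : L <= B <= A ->
    ((theta%:E * A%:E * (B%:E - L%:E) + L%:E * (A%:E - B%:E)) /
      (theta%:E * (B%:E - L%:E) + (A%:E - B%:E)))%E =
    ((theta * A * (B - L) + L * (A - B)) / (theta * (B - L) + (A - B)))%:E.
  move=> /andP[LB BA]; rewrite -!EFinB -!EFinM -!EFinD inver gt_eqF//; nra.
rewrite LE AE BuE BlE !real_formula; [|by apply/andP; split; lra..].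
rewrite /upper_intermediate_dim /lower_intermediate_dim.
have [->|theta_neq1] := eqVneq theta 1; first by rewrite BuE BlE !exponent1 ?lexx.
split; apply: le_ereal_inf_tmp => _ [s [s0 covs] <-]; rewrite lee_fin.
- apply: (intermediate_exponent_le F_nonempty F_totally_bounded AE LE) => //.
  + by apply/andP; split; lra.
  + move=> eps /covs[d0 /andP[d00 d01] covd].
    by exists (d0 / 2); [apply/andP; split; lra|apply: covd; lra].
  + move=> K g b r0 K0 g0 r00 NK; rewrite -lee_fin -BuE.
    have [d0 /andP[d00 _] covd] := covs 1 ltr01.
    apply: (upper_box_dim_le_powR F_nonempty K0 g0 r00 d00) => d dd0 dr0.
    by apply: NK => //; [case/andP: dd0|exact: covd].
- apply: (intermediate_exponent_le F_nonempty F_totally_bounded AE LE) => //.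
  + by apply/andP; split; lra.
  + by move=> eps eps0; apply: covs; rewrite ?ltr01 ?lexx.
  + move=> K g b r0 K0 g0 r00 NK; rewrite -lee_fin -BlE.
    by apply: (lower_box_dim_le_powR F_nonempty K0 g0 r00 _ NK) => d0; exact: covs.
Qed.
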